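(* Let $n$ and $\ell$ be integers with $-1\le \ell\le n-3$, let $t\in\{1,2,\ldots,n-1\}$, let $d$ be an integer with $0\le d\le \lfloor\frac{n+\ell-1}{2}\rfloor$, and let $G$ be an $n$-vertex graph with minimum degree $\delta(G)\ge d$. Suppose that at least one of the following is true, with the indicated value of $\ell$: (H1) $G$ is not Hamiltonian, and $\ell=0$; (H2) $G$ is not traceable, and $\ell=-1$; (H3) $G$ is not Hamiltonian-connected, and $\ell=1$; (H4) $G$ is not $k$-edge Hamiltonian for some integer $1\le k\le n-3$, and $\ell=k$; (H5) $G$ is not $k$-Hamiltonian for some integer $1\le k\le n-3$, and $\ell=k$. Then, with $i_d=\max\{1,d-\ell\}$ and $i_0=\lfloor\frac{n-1-\ell}{2}\rfloor$, $$s_t(G)\le \max\{s_t(G_n^{\ell}(i_d)),\,s_t(G_n^{\ell}(i_0))\}.$$ Moreover this bound is tight: in each of the cases (H1)--(H5) and for all admissible parameters, there is an $n$-vertex graph with minimum degree at least $d$ that does not have the corresponding property and for which equality holds.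
   Context: All graphs are finite and simple. $K_m$ is the complete graph and $I_m$ the edgeless graph on $m$ vertices; $\cup$ denotes disjoint union, and $A+B$ denotes the join (disjoint union of $A$ and $B$ together with all edges between them). For integers $n,i,\ell$ with $-1\le\ell\le n-3$ and $1\le i\le\frac{n-1-\ell}{2}$, define $G_n^{\ell}(i)=K_{i+\ell}+(I_i\cup K_{n-2i-\ell})$; when $i+\ell=0$ this is $I_1\cup K_{n-1}$. For $t\ge 1$, $s_t(G)$ is the number of $t$-stars (copies of $K_{1,t}$) in $G$: $s_t(G)=\sum_{v\in V(G)}\binom{d(v)}{t}$ for $t\ge 2$, and $s_1(G)=e(G)=\frac12\sum_{v}d(v)$. A graph is Hamiltonian if it has a Hamilton cycle (spanning cycle), traceable if it has a Hamilton path (spanning path), Hamiltonian-connected if it has a Hamilton path between every pair of distinct vertices. For $k\in\{0,\ldots,n-3\}$, an $n$-vertex graph $G$ is $k$-edge Hamiltonian if every linear forest in $G$ (disjoint union of paths) with at most $k$ edges is contained in a Hamilton cycle of $G$; it is $k$-Hamiltonian if the removal of any set of at most $k$ vertices results in a Hamiltonian graph. *)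

(* Defs.v *)
From HB Require Import structures.
From mathcomp Require Import all_boot all_order all_algebra.

Set Implicit Arguments.
Unset Strict Implicit.
Unset Printing Implicit Defensive.

Record sgraph := SGraph {
  vertex :> finType;
  adj : rel vertex;
  adj_sym : symmetric adj;
  adj_irrefl : irreflexive adj
}.

Section Basics.
Variable G : sgraph.

Definition nbrs (v : G) : {set G} := [set w | adj v w].

Definition degree (v : G) : nat := #|nbrs v|.

(* The default #|G| exceeds every degree, so it is irrelevant as soon as G has
   a vertex. *)
Definition min_degree : nat := \big[minn/#|G|]_(v : G) degree v.

Definition edges : {set {set G}} :=
  [set [set p.1; p.2] | p : G * G & adj p.1 p.2].

Lemma leq_min_degree d :
  0 < #|G| -> (d <= min_degree) = [forall v : G, d <= degree v].
Proof.
case/card_gt0P => v0 _; apply/idP/forallP => [dm v|dv].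
  apply: leq_trans dm _; rewrite /min_degree.
  elim: (index_enum G) (mem_index_enum v) => // u s IHs.
  rewrite inE big_cons geq_min => /predU1P[<-|vs]; first by rewrite leqnn.
  by rewrite IHs ?orbT.
have dG : d <= #|G| by apply: leq_trans (dv v0) (max_card _).
apply: (big_ind (fun m => d <= m)) => // x y dx dy; by rewrite leq_min dx.
Qed.

End Basics.

Section Constructions.

Lemma complete_sym m : symmetric (fun x y : 'I_m => x != y).
Proof. by move=> x y; rewrite eq_sym. Qed.
Lemma complete_irrefl m : irreflexive (fun x y : 'I_m => x != y).
Proof. by move=> x; rewrite eqxx. Qed.
Definition complete (m : nat) : sgraph :=
  SGraph (@complete_sym m) (@complete_irrefl m).

Lemma edgeless_sym m : symmetric (fun _ _ : 'I_m => false).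
Proof. by []. Qed.
Lemma edgeless_irrefl m : irreflexive (fun _ _ : 'I_m => false).
Proof. by []. Qed.
Definition edgeless (m : nat) : sgraph :=
  SGraph (@edgeless_sym m) (@edgeless_irrefl m).

Variables A B : sgraph.

(* [cross] tells whether the edges between A and B are all present. *)
Definition sum_adj (cross : bool) : rel (A + B)%type := fun x y =>
  match x, y with
  | inl a, inl a' => adj a a'
  | inr b, inr b' => adj b b'
  | _, _ => cross
  end.
Lemma sum_adj_sym cross : symmetric (sum_adj cross).
Proof. by move=> [a|b] [a'|b'] //=; rewrite adj_sym. Qed.
Lemma sum_adj_irrefl cross : irreflexive (sum_adj cross).
Proof. by move=> [a|b] /=; rewrite adj_irrefl. Qed.

Definition disjoint_union : sgraph :=
  SGraph (@sum_adj_sym false) (@sum_adj_irrefl false).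

Definition join : sgraph := SGraph (@sum_adj_sym true) (@sum_adj_irrefl true).

End Constructions.

Section Delete.
Variables (G : sgraph) (S : {set G}).

Definition del_adj : rel {x : G | x \notin S} := fun x y => adj (val x) (val y).
Lemma del_adj_sym : symmetric del_adj.
Proof. by move=> x y; apply: adj_sym. Qed.
Lemma del_adj_irrefl : irreflexive del_adj.
Proof. by move=> x; apply: adj_irrefl. Qed.
Definition delete : sgraph := SGraph del_adj_sym del_adj_irrefl.

End Delete.

(* The integer arguments of absz are nonnegative when -1 <= l <= n - 3 and
   1 <= i <= (n - 1 - l) / 2. If i + l = 0 the first factor of the join is the
   graph without vertices, and the join is the disjoint union of I_1 and
   K_(n-1). *)
Definition extremal_graph (n : nat) (l i : int) : sgraph :=
  join (complete (absz (i + l)%R))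
       (disjoint_union (edgeless (absz i))
                       (complete (absz (n%:Z - 2 * i - l)%R))).

(* The (not necessarily induced) subgraphs of G isomorphic to H, each given by
   its vertex set and its edge set. *)
Definition copies (H G : sgraph) : {set {set G} * {set {set G}}} :=
  [set (f @: [set: H], [set f @: (e : {set H}) | e in edges H])
  | f : {ffun H -> G} &
      injectiveb f && [forall x, forall y, adj x y ==> adj (f x) (f y)]].

(* K_{1,t} *)
Definition star (t : nat) : sgraph := join (complete 1) (edgeless t).

Definition num_stars (t : nat) (G : sgraph) : nat := #|copies (star t) G|.

Section CountingStars.
Variable G : sgraph.

Definition star_at (p : G * {set G}) : {set G} * {set {set G}} :=
  (p.1 |: p.2, [set [set p.1; w] | w in p.2]).

Lemma copies_star t :
  copies (star t) G =
  [set star_at p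
  | p : G * {set G} & (p.2 \subset nbrs p.1) && (#|p.2| == t)].
Proof.
have edgesE (f : {ffun star t -> G}) :
  [set f @: (e : {set star t}) | e in edges (star t)] =
  [set [set f (inl ord0); w] | w in [set f (inr j) | j : 'I_t]].
  apply/setP => F; apply/imsetP/imsetP.
  - case=> e /imsetP[[x y]]; rewrite inE /= => xy -> ->.
    case: x y xy => [a|a] [b|b] //=; rewrite ?(ord1 a) ?(ord1 b) // => _.
    + exists (f (inr b)); first by apply/imsetP; exists b.
      by rewrite imsetU1 imset_set1.
    + exists (f (inr a)); first by apply/imsetP; exists a.
      by rewrite imsetU1 imset_set1 setUC.
  - case=> w /imsetP[j _ ->] ->.
    exists [set inl ord0; inr j]; last by rewrite imsetU1 imset_set1.
    by apply/imsetP; exists (inl ord0, inr j); rewrite ?inE.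
have vertE (f : {ffun star t -> G}) :
  f @: [set: star t] = f (inl ord0) |: [set f (inr j) | j : 'I_t].
  apply/setP => v; rewrite in_setU1; apply/imsetP/orP.
  - case=> [[a|b] _ ->]; first by left; rewrite (ord1 a).
    by right; apply/imsetP; exists b.
  - case=> [/eqP->|/imsetP[j _ ->]]; by [exists (inl ord0) | exists (inr j)].
apply/setP => P; apply/imsetP/imsetP.
- case=> f; rewrite inE => /andP[/injectiveP inj_f /forallP hom_f] ->.
  exists (f (inl ord0), [set f (inr j) | j : 'I_t]); last first.
    by rewrite /star_at /= -edgesE -vertE.
  rewrite inE /=; apply/andP; split.
    apply/subsetP => w /imsetP[j _ ->]; rewrite inE.
    by have /forallP/(_ (inr j))/implyP := hom_f (inl ord0); apply.
  by rewrite card_imset ?card_ord // => i j /inj_f [].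
- case=> [[v S]]; rewrite inE /= => /andP[/subsetP SN /eqP cS] ->.
  pose f : {ffun star t -> G} :=
    [ffun x => match x with
               | inl _ => v
               | inr j => enum_val (cast_ord (esym cS) j)
               end].
  have fS : [set f (inr j) | j : 'I_t] = S.
    apply/setP => w; apply/imsetP/idP => [[j _ ->]|wS].
      by rewrite ffunE; apply: enum_valP.
    exists (cast_ord cS (enum_rank_in wS w)) => //.
    by rewrite ffunE cast_ordK enum_rankK_in.
  have fN j : adj v (f (inr j)).
    have := SN (f (inr j)); rewrite inE; apply; rewrite -fS.
    by apply/imsetP; exists j.
  have fv a : f (inl a) = v by rewrite ffunE.
  exists f; last by rewrite /star_at /= edgesE vertE fS fv.
  rewrite inE; apply/andP; split.
    apply/injectiveP => -[a|a] [b|b].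
    + by rewrite (ord1 a) (ord1 b).
    + by rewrite fv => vb; have := fN b; rewrite -vb adj_irrefl.
    + by rewrite fv => vb; have := fN a; rewrite vb adj_irrefl.
    + by rewrite !ffunE => /enum_val_inj/cast_ord_inj->.
  apply/forallP => -[a|a]; apply/forallP => -[b|b]; apply/implyP => //=.
  + by rewrite (ord1 a) (ord1 b).
  + by rewrite fv.
  + by rewrite fv adj_sym.
Qed.

Lemma num_stars_ge2 t : 2 <= t -> num_stars t G = \sum_(v : G) 'C(degree v, t).
Proof.
move=> t2; rewrite /num_stars copies_star card_in_imset; last first.
  move=> [v S] [v' S']; rewrite !inE /= => /andP[/subsetP SN /eqP cS].
  move=> /andP[/subsetP SN' /eqP cS'] [eqV eqE].
  have vS : v \notin S by apply/negP => /SN; rewrite inE adj_irrefl.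
  have vS' : v' \notin S' by apply/negP => /SN'; rewrite inE adj_irrefl.
  suff vv' : v = v'.
    by subst v'; congr pair; rewrite -(setU1K vS) eqV setU1K.
  have [//|nvv'] := eqVneq v v'.
  have /subset_leq_card : S \subset [set v'].
    apply/subsetP => w wS; rewrite inE.
    have : [set v; w] \in [set [set v'; w] | w in S'].
      by rewrite -eqE; apply/imsetP; exists w.
    case/imsetP => w' _ /setP/(_ v').
    rewrite !inE eqxx /= eq_sym (negPf nvv') /=.
    by rewrite eq_sym.
  by rewrite cards1 cS leqNgt t2.
rewrite -sum1_card.
pose Q (v : G) (S : {set G}) := (S \subset nbrs v) && (#|S| == t).
rewrite (eq_bigl (fun p => xpredT p.1 && Q p.1 p.2)); last first.
  by move=> p; rewrite inE.
rewrite -(pair_big_dep xpredT Q (fun _ _ => 1)) /=.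
apply: eq_bigr => v _; rewrite -cards_draws -sum1_card.
by apply: eq_bigl => S; rewrite inE.
Qed.

Lemma num_stars1 : num_stars 1 G = #|edges G|.
Proof.
rewrite /num_stars copies_star.
rewrite -(@card_imset _ _ (fun e : {set G} => (e, [set e])) (edges G));
  last by move=> e e' [].
apply: eq_card => P; apply/imsetP/imsetP.
- case=> [[v S]]; rewrite inE /= => /andP[/subsetP SN /cards1P[w Sw]] ->.
  exists [set v; w]; last by rewrite /star_at /= Sw imset_set1.
  apply/imsetP; exists (v, w) => //.
  by rewrite inE /=; have := SN w; rewrite Sw !inE eqxx; apply.
- case=> e /imsetP[[v w]]; rewrite inE /= => vw -> ->.
  exists (v, [set w]); last by rewrite /star_at /= imset_set1.
  by rewrite inE /= cards1 sub1set inE vw.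
Qed.

Lemma handshake : \sum_(v : G) degree v = (#|edges G|).*2.
Proof.
transitivity (\sum_(p : G * G | adj p.1 p.2) 1).
  rewrite (eq_bigl (fun p : G * G => xpredT p.1 && adj p.1 p.2)) //.
  rewrite -(pair_big_dep xpredT (fun v w : G => adj v w) (fun _ _ => 1)) /=.
  apply: eq_bigr => v _; rewrite /degree -sum1_card.
  by apply: eq_bigl => w; rewrite inE.
rewrite (partition_big (fun p : G * G => [set p.1; p.2]) (mem (edges G))) /=;
  last first.
  by move=> p ap; apply/imsetP; exists p; rewrite ?inE.
rewrite -muln2 -sum_nat_const; apply: eq_bigr => e /imsetP[[v w]].
rewrite inE /= => vw ->.
have nvw : v != w by apply/eqP => eqvw; have := vw; rewrite eqvw adj_irrefl.
rewrite sum1_card -(_ : #|[set (v, w); (w, v)]| = 2); last first.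
  by rewrite cards2 xpair_eqE negb_and nvw.
apply: eq_card => -[x y]; rewrite !inE unfold_in /= !xpair_eqE.
apply/andP/orP.
- case=> xy /eqP/setP eqs.
  have := eqs x; have := eqs y; rewrite !inE !eqxx orbT /=.
  have nxy : x != y by apply/eqP => eqxy; have := xy; rewrite eqxy adj_irrefl.
  move=> /esym/orP[]/eqP yE /esym/orP[]/eqP xE; subst;
    rewrite ?eqxx in nxy *; by [|left|right].
- by case=> /andP[/eqP-> /eqP->]; rewrite ?vw ?eqxx // adj_sym vw setUC eqxx.
Qed.
End CountingStars.

Section Hamiltonicity.
Variable G : sgraph.

Definition path_edges (p : seq G) : {set {set G}} :=
  [set:: [seq [set e.1; e.2] | e <- zip p (behead p)]].

Definition cycle_edges (c : seq G) : {set {set G}} :=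
  [set:: [seq [set e.1; e.2] | e <- zip c (rot 1 c)]].

(* The size condition matters: ucycle also holds of single edges. *)
Definition hamilton_cycle (c : seq G) : Prop :=
  [/\ 2 < size c, ucycle (@adj G) c & forall v, v \in c].

Definition hamilton_path (p : seq G) : Prop :=
  [/\ sorted (@adj G) p, uniq p & forall v, v \in p].

Definition hamiltonian : Prop := exists c, hamilton_cycle c.

Definition traceable : Prop := exists p, hamilton_path p.

Definition hamiltonian_connected : Prop :=
  forall x y : G, x != y -> exists p, hamilton_path (x :: p) /\ last x p = y.

(* F is the edge set of a disjoint union of paths of G. The trivial components
   of the forest are not recorded by F; they add no edge and lie on every
   spanning cycle. *)
Definition linear_forest (F : {set {set G}}) : Prop :=
  exists ps : seq (seq G),
    [/\ all (sorted (@adj G)) ps, uniq (flatten ps)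
      & F = \bigcup_(p <- ps) path_edges p].

Definition k_edge_hamiltonian (k : nat) : Prop :=
  forall F : {set {set G}}, linear_forest F -> #|F| <= k ->
    exists c, hamilton_cycle c /\ F \subset cycle_edges c.

End Hamiltonicity.

Definition k_hamiltonian (G : sgraph) (k : nat) : Prop :=
  forall S : {set G}, #|S| <= k -> hamiltonian (delete S).

(* Main.v *)
(** Each of the five properties passes from G + uv to G as soon as
    deg u + deg v >= n + l. Indeed each reduces to Hamilton cycles through a
    prescribed set of edges (traceability via the cone over G,
    Hamilton-connectedness via cycles through xy in G + xy), where Bondy and
    Chvatal's crossing argument works. Chvatal's argument on a nonadjacent pair
    of maximal degree sum then gives an i such that i vertices have degree at
    most i + l and n - i - l vertices have degree at most n - 1 - i, so the
    degrees of G are dominated by those of G_n^l(i), whose number of stars is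
    convex in i.

    Conversely, a cycle of G_n^l(i) enters and leaves each of the i independent
    vertices through K_(i+l). So if l of its edges lie inside K_(i+l), then it
    can never leave K_(i+l) towards the remaining clique. *)

Require Import Defs.
From HB Require Import structures.
From mathcomp Require Import all_boot all_order all_algebra.
From mathcomp Require Import zify.

Set Implicit Arguments.
Unset Strict Implicit.
Unset Printing Implicit Defensive.

(** * Edges of paths and cycles *)

Section PathEdges.
Variable G : sgraph.
Implicit Types (x y a b u v : G) (p q c : seq G) (F : {set {set G}}).

Lemma path_edges1 x : path_edges [:: x] = set0.
Proof. by apply/setP=> E; rewrite !inE. Qed.

Lemma path_edges_cons2 x y p :
  path_edges [:: x, y & p] = [set x; y] |: path_edges (y :: p).
Proof. by rewrite /path_edges /= set_cons. Qed.

Lemma path_edges_cat x p y q :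
  path_edges (x :: p ++ y :: q) =
  [set last x p; y] |: (path_edges (x :: p) :|: path_edges (y :: q)).
Proof.
elim: p x => [|z p IHp] x; first by rewrite path_edges1 set0U path_edges_cons2.
by rewrite cat_cons !path_edges_cons2 IHp /= setUCA -!setUA.
Qed.

Lemma path_edges_catl p q : path_edges p \subset path_edges (p ++ q).
Proof.
case: p => [|x p]; first by apply/subsetP=> E; rewrite !inE.
case: q => [|y q]; first by rewrite cats0.
by rewrite path_edges_cat setUCA subsetUl.
Qed.

Lemma path_edges_catr p q : path_edges q \subset path_edges (p ++ q).
Proof.
case: p => [|x p] //; case: q => [|y q]; first by apply/subsetP=> E;
  rewrite !inE.
by rewrite path_edges_cat setUA subsetUr.
Qed.

Lemma path_edges_rev p : path_edges (rev p) = path_edges p.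
Proof.
elim: p => [|x p IHp] //; case: p IHp => [|y p] IHp //.
rewrite path_edges_cons2 -IHp rev_cons -cats1.
have [z [q Eq]] : exists z q, rev (y :: p) = z :: q.
  by case: (rev _) (size_rev (y :: p)) => [|z q] // _; exists z, q.
rewrite Eq cat_cons path_edges_cat path_edges1 setU0.
have -> : last z q = y by rewrite -[last z q]/(last z (z :: q)) -Eq rev_cons
  last_rcons.
by rewrite setUC [[set y; x]]setUC setUC.
Qed.

Lemma cycle_edges_cons x p :
  cycle_edges (x :: p) = [set last x p; x] |: path_edges (x :: p).
Proof.
(* The closing vertex is generalized apart from the first one, since only the first vertex changes
   in the induction. *)
rewrite /cycle_edges rot1_cons; move: {2 4}x => y.
elim: p x => [|z p IHp] x /=; first by rewrite set_cons.
by rewrite set_cons IHp path_edges_cons2 setUCA.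
Qed.

Lemma path_edges_sub_cycle c : path_edges c \subset cycle_edges c.
Proof. by case: c => [|x p] //; rewrite cycle_edges_cons subsetUr. Qed.

Lemma zip_rot1_next c : uniq c ->
  zip c (rot 1 c) = [seq (x, next c x) | x <- c].
Proof.
case: c => // x p Uc; have szE : size (x :: p) = size (rot 1 (x :: p)).
  by rewrite size_rot.
apply: (@eq_from_nth _ (x, x)) => [|k].
  by rewrite size_map size1_zip // szE.
rewrite size1_zip ?szE // size_rot => kp.
rewrite nth_zip // (nth_map x) // next_nth mem_nth // index_uniq // rot1_cons.
(* At the last index the default of [nth] in [next_nth] is the head of the cycle, which is the entry
   that [rot 1] puts there. *)
by rewrite nth_rcons; case: ltnP => // le; rewrite if_same (nth_default x le).
Qed.

Lemma cycle_edgesE c : uniq c ->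
  cycle_edges c = [set [set x; next c x] | x in c].
Proof.
move=> Uc; rewrite /cycle_edges zip_rot1_next // -map_comp.
apply/setP=> E; rewrite inE; apply/mapP/imsetP => -[x xc ->];
  by exists x.
Qed.

Lemma cycle_edges_rot i c : uniq c -> cycle_edges (rot i c) = cycle_edges c.
Proof.
move=> Uc; rewrite !cycle_edgesE ?rot_uniq //.
apply/setP=> E; apply/imsetP/imsetP => -[x xc ->]; exists x;
  rewrite ?next_rot //; by rewrite mem_rot in xc *.
Qed.

Lemma path_edges_sub E p : E \in path_edges p -> {subset E <= p}.
Proof.
elim: p => [|x [|y p] IHp]; [by rewrite inE | by rewrite path_edges1 inE |].
rewrite path_edges_cons2 => /setU1P[->|/IHp sE] z; last first.
  by move/sE; rewrite [z \in x :: _]inE orbC => ->.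
by rewrite !inE => /orP[]->; rewrite ?orbT.
Qed.

Lemma card_path_edges p : uniq p -> #|path_edges p| = (size p).-1.
Proof.
elim: p => [|x [|y p] IHp]; rewrite ?path_edges1 ?cards0 //.
rewrite [uniq _]/= => /andP[xp Up]; rewrite path_edges_cons2 cardsU1 IHp //.
case: (boolP (_ \in _)) => // /path_edges_sub/(_ x).
by rewrite set21 (negPf xp) => /(_ isT).
Qed.

(** Indexing edges by their position lets [crossing] count sets of edges as sets of indices. *)
Lemma path_edges_nth x p :
  path_edges (x :: p) =
  [set [set nth x (x :: p) j; nth x p j] | j : 'I_(size p)].
Proof.
have szE : size (zip (x :: p) p) = size p by rewrite size_zip /=; lia.
have nthE (j : 'I_(size p)) : nth (x, x) (zip (x :: p) p) j = (nth x (x :: p)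
  j, nth x p j).
  by rewrite nth_zip_cond szE ltn_ord.
apply/setP=> E; rewrite inE; apply/mapP/imsetP.
  case=> e /(nthP (x, x))[j]; rewrite szE => jp <- ->.
  by exists (Ordinal jp); rewrite // (nthE (Ordinal jp)).
case=> j _ ->; exists (nth (x, x) (zip (x :: p) p) j); last by rewrite nthE.
by rewrite mem_nth // szE.
Qed.

(* If x is adjacent to b and last x p to a, for consecutive vertices a, b of the
   path, then replacing ab by these two edges gives a cycle; the degrees leave
   such a choice with ab outside F. *)
Lemma crossing x p F :
    uniq (x :: p) -> (forall v, v \in x :: p) -> path (@adj G) x p ->
    #|G| + #|F| <= degree x + degree (last x p) ->
  exists c, [/\ perm_eq c (x :: p), cycle (@adj G) c
              & path_edges (x :: p) :&: F \subset cycle_edges c].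
Proof.
move=> Uc allc xp; set y := last x p => le_deg.
(* [a j] and [b j] are the first and second end of the edge at position [j]. *)
pose a (j : 'I_(size p)) := nth x (x :: p) j;
  pose b (j : 'I_(size p)) := nth x p j.
pose A := [set j | adj x (b j)]; pose B := [set j | adj y (a j)].
pose C := [set j | [set a j; b j] \in F].
have cG : #|G| = (size p).+1.
  by rewrite -[RHS]/(size (x :: p)) -(card_uniqP Uc); apply: eq_card => v;
    rewrite allc.
have leA : degree x <= #|A|.
  rewrite -[#|A|]/(#|mem A|); apply: leq_trans (leq_imset_card b A).
  apply/subset_leq_card/subsetP => w; rewrite inE => xw.
  have wp : w \in p.
    by have := allc w; rewrite inE; case: eqP xw => // ->; rewrite adj_irrefl.
  have jp : index w p < size p by rewrite index_mem.
  apply/imsetP; exists (Ordinal jp); rewrite ?inE /b /= nth_index //.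
have leB : degree y <= #|B|.
  apply: leq_trans (leq_imset_card a B).
  apply/subset_leq_card/subsetP => w; rewrite inE => yw.
  (* The only index out of range is that of the last vertex [y], which is not adjacent to itself. *)
  have := allc w; rewrite -index_mem [size _]/= ltnS leq_eqVlt =>
    /predU1P[Ew|jp].
    have := nth_index x (allc w); rewrite Ew -last_nth => wE.
    by move: yw; rewrite /y wE adj_irrefl.
  by apply/imsetP; exists (Ordinal jp); rewrite ?inE /a nth_index.
have leC : #|C| <= #|F|.
  (* The path has as many edges as positions, so distinct positions carry distinct edges. *)
  have inj_ab : injective (fun j => [set a j; b j]).
    have /imset_injP inj : #|[set [set a j;
      b j] | j in [set: 'I_(size p)]]| == #|[set: 'I_(size p)]|.
      rewrite [X in _ == X]cardsT card_ord -[X in _ == X]/((size (x :: p)).-1).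
      rewrite -(card_path_edges Uc) path_edges_nth; apply/eqP/eq_card => E.
      by apply/imsetP/imsetP => -[j _ ->]; exists j; rewrite ?inE.
    by move=> j k jk; apply: inj; rewrite ?inE.
  rewrite -(card_imset (mem C) inj_ab); apply/subset_leq_card/subsetP.
  by move=> E /imsetP[j]; rewrite inE => jC ->.
(* [A] and [B] have at least [#|G| + #|F|] elements in total and their union has fewer than [#|G|],
   so they share more than [#|F|] positions; [C] cannot cover these. *)
have [j /setDP[]] : exists j, j \in (A :&: B) :\: C.
  apply/set0Pn; rewrite -card_gt0 cardsD.
  have : #|A :|: B| <= size p by rewrite -[leqRHS]card_ord max_card.
  by have := cardsUI A B; have := subset_leq_card (subsetIr (A :&: B) C); lia.
rewrite !inE => /andP[xb ya] abF.
have jp := ltn_ord j; pose p1 := take j p; pose p2 := drop j.+1 p.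
have pE : p = p1 ++ b j :: p2 by rewrite -drop_nth // cat_take_drop.
have aE : last x p1 = a j.
  by rewrite (last_nth x) size_takel 1?ltnW // -[x :: p1]/(take j.+1 (x :: p))
    nth_take.
have yE : last (b j) p2 = y by rewrite /y {1}pE last_cat.
have revE : rev (b j :: p2) = y :: rev (belast (b j) p2).
  by rewrite lastI rev_rcons yE.
have lastE z : last z (rev (b j :: p2)) = b j by rewrite rev_cons last_rcons.
(* The cycle follows the path from [x] to [a j], jumps to [y], runs back to [b j] and closes up at
   [x]. *)
exists (x :: p1 ++ rev (b j :: p2)); split.
- by rewrite perm_cons {1}pE perm_cat2l perm_rev.
- move: xp; rewrite {1}pE cat_path => /andP[xp1 /= /andP[_ bp2]].
  rewrite /= rcons_path cat_path xp1 last_cat lastE adj_sym xb andbT.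
  rewrite revE /= aE adj_sym ya /= -yE rev_path.
  by rewrite (@eq_path _ _ (@adj G)) // => u v; rewrite /= adj_sym.
- rewrite {1}pE path_edges_cat aE cycle_edges_cons revE path_edges_cat -revE
    path_edges_rev.
  apply/subsetP => E; rewrite !inE => /andP[/or3P[/eqP->|->|->]];
    rewrite ?orbT //.
  by rewrite (negPf abF).
Qed.

End PathEdges.

(** * The closure step *)

Section AddEdge.
Variables (G : sgraph) (u v : G).

(** The conjunct [x != y] keeps the relation irreflexive even when [u = v]. *)
Definition add_adj : rel G :=
  fun x y => adj x y || (x != y) && ([set x; y] == [set u; v]).

Lemma add_adj_sym : symmetric add_adj.
Proof. by move=> x y; rewrite /add_adj adj_sym eq_sym [[set y; x]]setUC. Qed.

Lemma add_adj_irrefl : irreflexive add_adj.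
Proof. by move=> x; rewrite /add_adj adj_irrefl eqxx. Qed.

Definition add_edge : sgraph := SGraph add_adj_sym add_adj_irrefl.

Lemma sub_add_adj : subrel (@adj G) add_adj.
Proof. by move=> x y xy; rewrite /add_adj xy. Qed.

Lemma leq_degree_add (x : G) : degree x <= @degree add_edge x.
Proof.
by apply/subset_leq_card/subsetP => w; rewrite !inE; apply: sub_add_adj.
Qed.

Lemma adj_add_edge : u != v -> @adj add_edge u v.
Proof. by move=> uv; rewrite /= /add_adj uv eqxx orbT. Qed.

End AddEdge.

Lemma mem_edges (G : sgraph) (x y : G) : ([set x; y] \in edges G) = adj x y.
Proof.
apply/imsetP/idP => [[[a b]]|xy]; last by exists (x, y); rewrite ?inE.
rewrite inE /= => ab E.
have nab : a != b by apply/eqP => eqab; have := ab; rewrite eqab adj_irrefl.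
have : a \in [set x; y] by rewrite E set21.
have : b \in [set x; y] by rewrite E set22.
have : x \in [set a; b] by rewrite -E set21.
have : y \in [set a; b] by rewrite -E set22.
rewrite !inE; do 4![case/orP=> /eqP ?]; subst; rewrite ?eqxx // in nab *.
all: by rewrite adj_sym.
Qed.

Definition ham_through (G : sgraph) (F : {set {set G}}) : Prop :=
  exists c, @hamilton_cycle G c /\ F \subset cycle_edges c.

Lemma hamiltonian_through0 (G : sgraph) : hamiltonian G <-> @ham_through G set0.
Proof.
by split=> [[c hc]|[c [hc _]]]; exists c => //; split=> //; apply: sub0set.
Qed.

Lemma size_hamilton (G : sgraph) (c : seq G) :
  uniq c -> (forall v, v \in c) -> size c = #|G|.
Proof. by move=> Uc allc; rewrite -(card_uniqP Uc); apply: eq_card => v;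
  rewrite allc. Qed.

(** On a duplicate-free list, [next] sends the last entry to the head and is injective. *)
Lemma last_next (T : eqType) (c : seq T) (x y : T) s :
  uniq c -> x \in c -> next c x = y -> perm_eq (y :: s) c -> 
  next (y :: s) =1 next c -> last y s = x.
Proof.
move=> Uc xc nx pc En; have Us : uniq (y :: s) by rewrite (perm_uniq pc).
apply: (can_inj (prev_next Us)); rewrite [RHS]En nx.
have := next_nth (y :: s) (last y s); rewrite mem_last.
by move=> ->; rewrite -[index _ _]/(index _ (y :: s)) index_last // nth_default.
Qed.

(** The ends of a duplicate-free list of at least three entries are never consecutive in it, so no
    step of the path uses the edge [uv] that joins them. *)
Lemma path_add_closing (G : sgraph) (u v y : G) s :
    uniq (y :: s) -> 1 < size s -> path (add_adj u v) y s ->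
  [set last y s; y] = [set u; v] -> path (@adj G) y s.
Proof.
move=> Us szs /(pathP y) ps Euv; apply/(pathP y) => k ks.
case/orP: (ps k ks) => // /andP[_ /eqP].
pose a j := nth y (y :: s) j.
rewrite -Euv setUC (last_nth y) -[nth y s k]/(a k.+1) -[nth y _ k]/(a k).
rewrite -[[set _; y]]/[set a (size s); a 0] => /setP E.
have := E (a k.+1); have := E (a k); rewrite !inE !eqxx orbT.
by rewrite !nth_uniq //= 1?ltnS 1?ltnW // => /esym E1 /esym E2; exfalso; lia.
Qed.

(** A cycle that does not already lie in [G] uses [uv]. Cut open there, it is a Hamilton path of
    [G], which [crossing] closes up again without losing edges of [F]. *)
Lemma ham_through_stable (G : sgraph) (u v : G) (F : {set {set G}}) :
    F \subset edges G -> u != v -> #|G| + #|F| <= degree u + degree v ->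
  @ham_through (add_edge u v) F -> ham_through F.
Proof.
move=> FG nuv le_deg [c [[szc /andP[cyc Uc] allc] Fc]].
(* [add_edge u v] has the vertices of [G], so [c] can be read as a list over [G]. *)
change (seq G) in c; change (is_true (2 < @size G c)) in szc;
  change (is_true (@uniq G c)) in Uc;
    change (is_true (cycle (add_adj u v) c)) in cyc.
change (is_true (F \subset @cycle_edges G c)) in Fc.
have [cycG|] := boolP (cycle (@adj G) c).
  by exists c; split=> //; split=> //; apply/andP.
move=> ncyc.
have /hasP[x xc nx] : has (fun x => ~~ adj x (next c x)) c.
  apply: contraNT ncyc => /hasPn h; apply: cycle_from_next => // x xc.
  by have := h x xc; rewrite negbK.
have [i s rE] : rot_to_spec c (next c x) by apply: rot_to; rewrite mem_next.
set y := next c x in rE nx *.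
have Ex : last y s = x.
  by apply: (@last_next _ c) => //; [rewrite -rE perm_rot | rewrite -rE;
    apply: next_rot].
have Euv : [set x; y] = [set u; v].
  by have := next_cycle cyc xc; rewrite /add_adj (negPf nx) => /andP[_ /eqP].
have Us : uniq (y :: s) by rewrite -rE rot_uniq.
have ys : path (@adj G) y s.
  apply: (@path_add_closing _ u v) => //; last by rewrite Ex.
    by rewrite -ltnS -[(size s).+1]/(size (y :: s)) -rE size_rot.
  by move: cyc; rewrite -(rot_cycle i) rE /= rcons_path => /andP[].
have alls w : w \in y :: s by rewrite -rE mem_rot.
have le_deg' : #|G| + #|F| <= degree y + degree (last y s).
  suff -> : degree y + degree (last y s) = degree u + degree v by [].
  rewrite Ex addnC; have := Euv => /setP E.
  have := E x; have := E y; have := E u; have := E v;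
    rewrite !inE !eqxx ?orbT /=.
  have nxy : x != y by have := next_cycle cyc xc => /orP[|/andP[]//];
    rewrite (negPf nx).
  move=> /orP[]/eqP ? /orP[]/eqP ?; subst u v; rewrite ?eqxx // in nuv *.
  by rewrite addnC.
have [c' [pc cyc' sub]] := crossing Us alls ys le_deg'.
exists c'; split.
  split; first by rewrite (perm_size pc) -rE size_rot.
    by rewrite /ucycle cyc' (perm_uniq pc).
  by move=> w; rewrite (perm_mem pc) -rE mem_rot.
apply: subset_trans sub; apply/subsetP => E EF; rewrite inE EF andbT.
move: (subsetP Fc _ EF); rewrite -(@cycle_edges_rot G i c Uc) rE
  cycle_edges_cons.
(* The cut edge [xy] is not in [F]: it is no edge of [G], while all of [F] is. *)
case/setU1P=> // EE; have := subsetP FG _ EF.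
by rewrite EE Ex mem_edges (negPf nx).
Qed.

(** * Chvatal's degree condition *)

Definition nonedges (G : sgraph) : {set G * G} :=
  [set p | (p.1 != p.2) && ~~ adj p.1 p.2].

Lemma card_nonnbrs (G : sgraph) (v : G) :
  #|[set w | (w != v) && ~~ adj v w]| = #|G|.-1 - degree v.
Proof.
have -> : [set w | (w != v) && ~~ adj v w] = ~: (v |: nbrs v).
  by apply/setP => w; rewrite !inE negb_or.
by rewrite cardsCs setCK cardsU1 inE adj_irrefl /= -/(degree v) subnDA subn1.
Qed.

(* [m] stands for l + 1, which is nonnegative. *)
Lemma chvatal_degrees (P : sgraph -> Prop) (n m : nat) : m.+2 <= n ->
    (forall H : sgraph, #|H| = n -> (forall u v : H, u != v -> adj u v) ->
      P H) ->
    (forall (H : sgraph) (u v : H), #|H| = n -> u != v ->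
       n + m <= (degree u + degree v).+1 -> P (add_edge u v) -> P H) ->
  forall G : sgraph, #|G| = n -> ~ P G ->
  exists i, [/\ 0 < i, 2 * i + m <= n, i <= #|[set v : G | degree v < i + m]|
              & n < i + m + #|[set v : G | degree v < n - i]|].
Proof.
move=> mn Pcomplete Pstable G.
have [N] := ubnP #|nonedges G|; elim: N G => // N IHN G ltN cG nP.
have [p0 p0G] : exists p, p \in nonedges G.
  apply/set0Pn/eqP => E; apply/nP/Pcomplete => // u v uv.
  by have : (u, v) \notin nonedges G; [rewrite E inE | rewrite inE /= uv negbK].
pose f (p : G * G) := degree p.1 + degree p.2.
have [[u v] uvG maxf] : exists2 p, p \in nonedges G & forall q, q \in nonedges
  G -> f q <= f p.
  by case: (@arg_maxnP _ p0 (mem (nonedges G)) f p0G) => p; exists p.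
wlog le_uv : u v uvG maxf / degree u <= degree v.
  move=> W; have /orP[le|le] := leq_total (degree u) (degree v);
    first exact: (W u v).
  apply: (W v u) => //; first by move: uvG; rewrite !inE /= eq_sym adj_sym.
  by move=> p /maxf; rewrite /f /= [degree v + _]addnC.
move: (uvG); rewrite inE /= => /andP[nuv auv].
(* If the degree sum is large, [add_edge u v] also lacks [P] and has fewer nonedges. Its degrees are
   no smaller than those of [G], so its index [i] serves [G] too. *)
have [le_s|lt_s] := leqP (n + m) (degree u + degree v).+1.
  have [||i [i0 im ci1 ci2]] := IHN (add_edge u v) _ cG.
  - rewrite -ltnS; apply: leq_trans ltN; rewrite ltnS;
      apply/proper_card/properP; split.
      apply/subsetP => -[x y]; rewrite !inE /= => /andP[-> /=].
      by apply: contra; apply: sub_add_adj.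
    by exists (u, v) => //; rewrite inE /= /add_adj nuv eqxx orbT.
  - by move=> Padd; apply/nP/(Pstable G u v).
  exists i; split=> //.
    apply: leq_trans ci1 _; apply/subset_leq_card/subsetP => w; rewrite !inE.
    by apply: leq_ltn_trans; apply: leq_degree_add.
  apply: leq_trans ci2 _; rewrite leq_add2l;
    apply/subset_leq_card/subsetP => w; rewrite !inE.
  by apply: leq_ltn_trans; apply: leq_degree_add.
have degmax (w w' : G) : w != w' -> ~~ adj w w' ->
  degree w + degree w' <= degree u + degree v.
  by move=> ww' aww'; have := maxf (w, w'); rewrite inE /= ww' aww' => /(_ isT).
have cv := card_nonnbrs v; have cu := card_nonnbrs u.
have subv : [set w | (w != v) && ~~ adj v w] \subset [set w | degree w <=
  degree u].
  by apply/subsetP => w; rewrite !inE adj_sym => /andP[wv /(degmax _ _ wv)];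
    lia.
have [le_m|lt_m] := leqP m (degree u).
  (* With this choice [i + m] is [(degree u).+1], so by maximality every non-neighbour of [v] has
     degree below [i + m]; the small degree sum makes them at least [i] in number. *)
  exists ((degree u).+1 - m); split; [lia | lia | |].
    apply: (@leq_trans (#|G|.-1 - degree v)); [lia | rewrite -cv].
    apply/subset_leq_card/(subset_trans subv)/subsetP => w; rewrite !inE; lia.
  (* [u] and its non-neighbours have degree at most [degree v], which is below [n - i]. *)
  have : u |: [set w | (w != u) && ~~ adj u w] \subset [set w | degree w < n -
    ((degree u).+1 - m)].
    rewrite subUset sub1set inE; apply/andP; split; first by lia.
    by apply/subsetP => w; rewrite !inE adj_sym => /andP[wu /(degmax _ _ wu)];
      lia.
  by move/subset_leq_card; rewrite cardsU1 inE eqxx /= cu; lia.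
(* Here [degree u < m]: [u] alone gives the first count, and each non-neighbour of [u] misses [u],
   so its degree is below [n - 1]. *)
exists 1; split; [by [] | lia | |].
  by rewrite card_gt0; apply/set0Pn; exists u; rewrite inE; lia.
have : [set w | (w != u) && ~~ adj u w] \subset [set w | degree w < n - 1].
  apply/subsetP => w; rewrite !inE => /andP[wu auw].
  have := card_nonnbrs w; have : 0 < #|[set x | (x != w) && ~~ adj w x]|.
    by rewrite card_gt0; apply/set0Pn; exists u; rewrite inE eq_sym wu adj_sym.
  lia.
by move/subset_leq_card; rewrite cu; lia.
Qed.

(** * The five properties *)

(** Both graphs are explicit [SGraph] terms over one vertex type, so that [F] and the cycle are
    shared by them without any transport. *)
Lemma ham_through_mono (T : finType) (e1 e2 : rel T) s1 i1 s2 i2 F :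
  subrel e1 e2 -> @ham_through (@SGraph T e1 s1 i1) F ->
    @ham_through (@SGraph T e2 s2 i2) F.
Proof.
move=> sub12 [c [[szc /andP[cyc Uc] allc] Fc]]; exists c; split=> //;
  split=> //.
by rewrite /ucycle (sub_cycle sub12 cyc).
Qed.

Lemma hamiltonian_mono (T : finType) (e1 e2 : rel T) s1 i1 s2 i2 :
  subrel e1 e2 -> hamiltonian (@SGraph T e1 s1 i1) ->
    hamiltonian (@SGraph T e2 s2 i2).
Proof.
by move=> sub12 /hamiltonian_through0 h; apply/hamiltonian_through0;
  apply: ham_through_mono h.
Qed.

Lemma hamiltonian_stable (G : sgraph) (u v : G) :
  u != v -> #|G| <= degree u + degree v -> hamiltonian (add_edge u v) ->
    hamiltonian G.
Proof.
move=> nuv le_deg /hamiltonian_through0 h; apply/hamiltonian_through0.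
by apply: ham_through_stable nuv _ h; rewrite ?sub0set ?cards0 ?addn0.
Qed.

(** * Complete graphs have the five properties *)

Section CompleteGraphs.
Variable G : sgraph.
Hypothesis adjG : forall u v : G, u != v -> adj u v.

Lemma sorted_complete (p : seq G) : uniq p -> sorted (@adj G) p.
Proof.
rewrite uniq_pairwise => /pairwise_sorted; apply: sub_sorted => x y;
  exact: adjG.
Qed.

Lemma hamilton_cycle_complete (c : seq G) :
  2 < size c -> uniq c -> (forall v, v \in c) -> hamilton_cycle c.
Proof.
case: c => // x p szc Uc allc; split=> //;
  rewrite /ucycle Uc andbT /= rcons_path.
have /= -> := sorted_complete Uc; apply: adjG; move: szc Uc => /=.
case: p {allc} => // y p _ /andP[xp _]; apply: contraNneq xp => <-;
  exact: (mem_last y p).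
Qed.

Lemma hamiltonian_complete : 2 < #|G| -> hamiltonian G.
Proof.
move=> cG; exists (enum G); apply: hamilton_cycle_complete;
  rewrite -?cardE ?enum_uniq //.
by move=> v; rewrite mem_enum.
Qed.

Lemma traceable_complete : traceable G.
Proof.
exists (enum G); split; rewrite ?sorted_complete ?enum_uniq // => v.
by rewrite mem_enum.
Qed.

Lemma hamiltonian_connected_complete : hamiltonian_connected G.
Proof.
move=> x y nxy; pose p := rem y (rem x (enum G)).
have U : uniq (x :: rcons p y).
  rewrite /= mem_rcons inE (negPf nxy) rcons_uniq !(mem_rem_uniq, rem_uniq,
    enum_uniq) //.
  by rewrite !inE !eqxx /= mem_rem_uniq ?enum_uniq // !inE eqxx andbF.
exists (rcons p y); rewrite last_rcons; split=> //; split=> //;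
  first exact: sorted_complete.
move=> v; rewrite inE mem_rcons inE mem_rem_uniq ?rem_uniq ?enum_uniq //.
rewrite !inE mem_rem_uniq ?enum_uniq // !inE.
by rewrite mem_enum andbT; case: (v == x); case: (v == y).
Qed.

(** Concatenating the paths of the forest and appending the other vertices gives a cycle in which
    each edge of the forest joins consecutive entries. *)
Lemma k_edge_hamiltonian_complete k : 2 < #|G| -> k_edge_hamiltonian G k.
Proof.
move=> cG F [ps [_ Ups ->]] _;
  pose c := flatten ps ++ [seq x <- enum G | x \notin flatten ps].
have Uc : uniq c.
  rewrite cat_uniq Ups filter_uniq ?enum_uniq // andbT /=.
  by apply/hasPn => x; rewrite mem_filter => /andP[].
have allc v : v \in c by rewrite mem_cat mem_filter mem_enum andbT orbN.
exists c; split.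
  by apply: hamilton_cycle_complete => //; rewrite size_hamilton.
apply: subset_trans (path_edges_sub_cycle _);
  apply: subset_trans (path_edges_catl _ _).
elim: ps {c Ups Uc allc} => [|p ps IHps]; first by rewrite big_nil sub0set.
rewrite big_cons subUset path_edges_catl; apply: subset_trans IHps _;
  exact: path_edges_catr.
Qed.

End CompleteGraphs.

Lemma k_hamiltonian_complete (G : sgraph) k : (forall u v : G, u != v ->
  adj u v) ->
  k.+2 < #|G| -> k_hamiltonian G k.
Proof.
move=> adjG cG S cS; apply: hamiltonian_complete => [x y nxy|].
  by apply: adjG; rewrite (inj_eq val_inj).
rewrite card_sig; have E := cardsC S.
have -> : #|[pred x | x \notin S]| = #|~: S| by apply: eq_card => x;
  rewrite !inE.
lia.
Qed.

Section SumDegrees.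
Variables A B : sgraph.

Lemma card_sum_set (P : pred (A + B)) :
  #|[set x | P x]| = #|[set a | P (inl a)]| + #|[set b | P (inr b)]|.
Proof.
rewrite -!sum1_card big_sumType /=; congr (_ + _); by apply: eq_bigl => x;
  rewrite !inE.
Qed.

Lemma degree_join_inl (a : A) : @degree (join A B) (inl a) = degree a + #|B|.
Proof. by rewrite /degree /nbrs card_sum_set /= -cardsT. Qed.

Lemma degree_join_inr (b : B) : @degree (join A B) (inr b) = #|A| + degree b.
Proof. by rewrite /degree /nbrs card_sum_set /= -cardsT. Qed.

Lemma degree_union_inl (a : A) : @degree (disjoint_union A B) (inl a) = degree
  a.
Proof. by rewrite /degree /nbrs card_sum_set /= -[[set _ | false]]/set0 cards0
  addn0. Qed.

Lemma degree_union_inr (b : B) : @degree (disjoint_union A B) (inr b) = degree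
  b.
Proof. by rewrite /degree /nbrs card_sum_set /= -[[set _ | false]]/set0 cards0.
  Qed.

End SumDegrees.

(** * Traceability as Hamiltonicity of the cone *)

Section Cone.
Variable G : sgraph.
Let K1G := join (complete 1) G.

(** The apex closes the path to a cycle, and [1 < #|G|] makes that cycle have at least three
    vertices. *)
Lemma traceable_hamiltonian_cone : 1 < #|G| -> traceable G -> hamiltonian K1G.
Proof.
move=> cG [p [sp Up allp]]; pose c : seq K1G := inl ord0 :: map inr p.
have szp : size p = #|G| by apply: size_hamilton.
have inr_inj : injective (@inr 'I_1 G) by move=> a b [].
exists c; split.
- by rewrite /= size_map szp.
- rewrite /ucycle [uniq _]/= map_inj_uniq // Up andbT; apply/andP; split;
    last first.
    by apply/mapP => -[].
  rewrite /c; case: p sp szp {Up allp c} => [|x p xp _]; first by move=> _ E;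
    move: cG; rewrite -E.
  by rewrite [cycle _ _]/= rcons_path path_map (xp : path _ _ _) last_map.
- move=> [a|b]; first by rewrite (fintype.ord1 a) inE eqxx.
  by rewrite inE /= mem_map.
Qed.

Lemma hamiltonian_cone_traceable : hamiltonian K1G -> traceable G.
Proof.
case=> c [szc /andP[cyc Uc] allc].
have [i s rE] := rot_to (allc (inl ord0)).
have : uniq (inl ord0 :: s) by rewrite -rE rot_uniq.
have : cycle (@adj K1G) (inl ord0 :: s) by rewrite -rE rot_cycle.
have alls v : v \in (inl ord0 :: s : seq K1G) by rewrite -rE mem_rot.
rewrite /= rcons_path => /andP[ps _] /andP[ns Us].
(* [pmap g] strips the tag [inr]; nothing is lost, as the apex does not occur in [s]. *)
pose g (x : K1G) : option G := if x is inr b then Some b else None.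
have sE : s = map inr (pmap g s).
  elim: s ns {rE alls ps Us} => [|[a|b] s IHs] //=; rewrite inE negb_or.
    by rewrite (fintype.ord1 a) eqxx.
  by move=> /andP[_ /IHs <-].
have inr_inj : injective (@inr 'I_1 G) by move=> a b [].
exists (pmap g s); split.
- by move/path_sorted: ps; rewrite {1}sE sorted_map.
- by move: Us; rewrite {1}sE map_inj_uniq.
- by move=> v; have := alls (inr v); rewrite inE {1}sE mem_map.
Qed.

End Cone.

(** In the cone both degrees and the order grow by one, which turns the hypothesis into that of
    [hamiltonian_stable]. *)
Lemma traceable_stable (G : sgraph) (u v : G) : 1 < #|G| -> u != v ->
  #|G| <= (degree u + degree v).+1 -> traceable (add_edge u v) -> traceable G.
Proof.
move=> cG nuv le_deg /(@traceable_hamiltonian_cone (add_edge u v) cG) h.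
apply: hamiltonian_cone_traceable.
apply: (@hamiltonian_stable (join (complete 1) G) (inr u) (inr v)) => //.
  by rewrite !degree_join_inr card_sum !card_ord; lia.
apply: hamiltonian_mono h => -[a|a] [b|b] //=; rewrite /add_adj //=;
  first by move=> ->.
case/orP=> [->//|/andP[nab /eqP E]]; rewrite -[inr a == _]/(a == b) nab orbC /=.
have := congr1 (fun X : {set G} => [set @inr 'I_1 G x | x in X]) E.
by rewrite !imsetU1 !imset_set1 => ->; rewrite eqxx.
Qed.

(** With its converse below, this trades Hamilton paths from [x] to [y] for Hamilton cycles of
    [G + xy] through [xy], to which [ham_through_stable] applies. *)
Lemma ham_connected_through (G : sgraph) (x y : G) p : 2 < #|G| -> x != y ->
  @hamilton_path G (x :: p) -> last x p = y ->
  @ham_through (add_edge x y) [set [set x; y]].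
Proof.
move=> cG nxy [xp Up allp] lp; exists (x :: p); split; last first.
  rewrite sub1set; have := @cycle_edges_cons (add_edge x y) x p.
  by rewrite /= lp => ->; rewrite setUC; apply/setU1P; left; rewrite setUC.
split=> //; first by rewrite (@size_hamilton G).
rewrite /ucycle Up andbT /= rcons_path (sub_path (@sub_add_adj G x y)) //= lp.
by rewrite /add_adj eq_sym nxy setUC eqxx orbT.
Qed.

Lemma ham_through_connected (G : sgraph) (x y : G) : x != y ->
  @ham_through (add_edge x y) [set [set x; y]] ->
  exists p, @hamilton_path G (x :: p) /\ last x p = y.
Proof.
move=> nxy [c [[szc /andP[cyc Uc] allc]]].
change (seq G) in c; change (is_true (2 < @size G c)) in szc.
change (is_true (@uniq G c)) in Uc;
  change (is_true (cycle (add_adj x y) c)) in cyc.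
change (forall v : G, v \in c) in allc.
rewrite sub1set => E; have {E} : [set x; y] \in @cycle_edges G c by [].
rewrite cycle_edgesE // => /imsetP[w wc E].
have [i s rE] : rot_to_spec c (next c w) by apply: rot_to; rewrite mem_next.
set z := next c w in E rE *.
have lw : last z s = w.
  by apply: (@last_next _ c) => //; [rewrite -rE perm_rot | rewrite -rE;
    apply: next_rot].
have Us : uniq (z :: s) by rewrite -rE rot_uniq.
have zs : path (@adj G) z s.
  apply: (@path_add_closing _ x y) => //; last by rewrite lw.
    by rewrite -ltnS -[(size s).+1]/(size (z :: s)) -rE size_rot.
  by move: cyc; rewrite -(rot_cycle i) rE /= rcons_path => /andP[].
have alls v : v \in z :: s by rewrite -rE mem_rot.
have : x \in [set w; z] by rewrite -E set21.
have : y \in [set w; z] by rewrite -E set22.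
rewrite !inE => /orP[]/eqP Ey /orP[]/eqP Ex; rewrite {1}Ex Ey ?eqxx // in nxy.
  by exists s; rewrite Ex Ey.
(* The cut path runs from [y] to [x] in this case, so it is reversed. *)
have rsE : rev (z :: s) = x :: rev (belast z s) by rewrite lastI rev_rcons lw
  Ex.
exists (rev (belast z s)); rewrite -rsE; split.
  split; rewrite ?rev_uniq //; last by move=> v; rewrite mem_rev.
  by rewrite rev_sorted /= (@eq_path _ _ (@adj G)) // => a b; rewrite adj_sym.
by rewrite -[last _ _]/(last x (x :: rev (belast z s))) -rsE rev_cons
  last_rcons Ey.
Qed.

(** The closure step is applied to [G + xy] with [F] the single edge [xy], which accounts for the
    strict inequality. *)
Lemma hamiltonian_connected_stable (G : sgraph) (u v : G) : 2 < #|G| ->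
  u != v ->
  #|G| < degree u + degree v -> hamiltonian_connected (add_edge u v) ->
  hamiltonian_connected G.
Proof.
move=> cG nuv le_deg hc x y nxy; have [p [hp lp]] := hc x y nxy.
apply: ham_through_connected => //.
have h := @ham_connected_through (add_edge u v) x y p cG nxy hp lp.
apply: (@ham_through_stable (add_edge x y) u v) => //.
- by rewrite sub1set mem_edges adj_add_edge.
- rewrite cards1 addn1; apply: leq_trans le_deg _.
  by apply: leq_add; apply: leq_degree_add.
(* Adding [uv] and [xy] in either order gives the same adjacency. *)
apply: ham_through_mono h => a b; rewrite /add_adj /= /add_adj.
by rewrite orbAC.
Qed.

Lemma linear_forest_edges (G : sgraph) F : @linear_forest G F ->
  F \subset edges G.
Proof.
case=> ps [sps _ ->]; elim: ps sps => [|p ps IHps] /=;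
  first by rewrite big_nil sub0set.
case/andP=> sp /IHps sps; rewrite big_cons subUset sps andbT.
elim: p sp => [|x [|y p] IHp]; first by move=> _; apply/subsetP => E;
  rewrite inE.
  by rewrite path_edges1 sub0set.
by move=> /= /andP[xy yp];
  rewrite path_edges_cons2 subUset sub1set mem_edges xy IHp.
Qed.

Lemma k_edge_hamiltonian_stable (G : sgraph) (u v : G) k : u != v ->
  #|G| + k <= degree u + degree v -> k_edge_hamiltonian (add_edge u v) k ->
  k_edge_hamiltonian G k.
Proof.
move=> nuv le_deg kG F linF cF; apply: ham_through_stable nuv _ _.
- exact: linear_forest_edges.
- by apply: leq_trans le_deg; rewrite leq_add2l.
apply: kG => //; case: linF => ps [sps Ups ->]; exists ps; split=> //.
by apply: sub_all sps => p; apply: sub_sorted; apply: sub_add_adj.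
Qed.

Lemma degree_delete (G : sgraph) (S : {set G}) (x : {x : G | x \notin S}) :
  degree (val x) <= #|S| + @degree (delete S) x.
Proof.
have sub : nbrs (val x) \subset S :|: [set val w | w in @nbrs (delete S) x].
  apply/subsetP => w; rewrite !inE => xw; case: (boolP (w \in S)) => //= wS.
  by apply/imsetP; exists (exist _ w wS); rewrite ?inE.
apply: leq_trans (subset_leq_card sub) _;
  apply: leq_trans (leq_card_setU _ _) _.
by rewrite leq_add2l leq_imset_card.
Qed.

Lemma card_delete (G : sgraph) (S : {set G}) : #|delete S| = #|G| - #|S|.
Proof.
rewrite card_sig -(cardsC S) addKn; apply: eq_card => x; by rewrite !inE.
Qed.

(** If [S] contains [u] or [v], its deletion removes the added edge. Otherwise each degree drops by
    at most [#|S|] and the order by exactly [#|S|], and [#|S| <= k] covers the difference. *)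
Lemma k_hamiltonian_stable (G : sgraph) (u v : G) k : u != v ->
  #|G| + k <= degree u + degree v -> k_hamiltonian (add_edge u v) k ->
  k_hamiltonian G k.
Proof.
move=> nuv le_deg kG S cS; have := kG S cS => {kG} h.
have [uvS|] := boolP ((u \in S) || (v \in S)).
  apply: hamiltonian_mono h => x y; rewrite /del_adj /= /add_adj.
  case/orP=> // /andP[_ /eqP E].
  have : u \in [set val x; val y] by rewrite E set21.
  have : v \in [set val x; val y] by rewrite E set22.
  rewrite !inE => /orP Ev /orP Eu; move: uvS.
  by case: Eu => /eqP->; case: Ev => /eqP->;
    rewrite ?(negPf (valP x)) ?(negPf (valP y)).
rewrite negb_or => /andP[uS vS].
pose u' : delete S := exist _ u uS; pose v' : delete S := exist _ v vS.
apply: (@hamiltonian_stable (delete S) u' v') => //.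
  have du : degree u <= #|S| + degree u' := degree_delete u'.
  have dv : degree v <= #|S| + degree v' := degree_delete v'.
  by rewrite card_delete; change (is_true (#|S| <= k)) in cS; lia.
apply: hamiltonian_mono h => x y; rewrite /del_adj /= /add_adj.
case/orP=> [xy|/andP[nxy E]]; first by rewrite /= /del_adj xy.
rewrite -(inj_eq val_inj) nxy /=; apply/orP; right.
by rewrite -(inj_eq (imset_inj val_inj)) !imsetU1 !imset_set1.
Qed.

(** * The extremal graphs *)

(** The predecessors of [A] lie in [B] and have successors outside [B], while each edge of [F]
    starts at a vertex of [B] whose successor is in [B]. By the size condition these two disjoint
    sets fill [B], so [next c] preserves [A :|: B] and never reaches [w]. *)
Lemma no_hamilton_cycle (G : sgraph) (A B : {set G}) (F : {set {set G}}) (w :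
  G) :
    A != set0 -> [disjoint A & B] -> w \notin A :|: B ->
    (forall x, x \in A -> nbrs x \subset B) ->
    (forall E, E \in F -> E \subset B) -> #|B| <= #|A| + #|F| ->
  ~ ham_through F.
Proof.
move=> /set0Pn[a0 a0A] dAB wAB nbA FB leB [c [[szc /andP[cyc Uc] allc] Fc]].
have nextA x : x \in A -> next c x \in B.
  by move=> xA; apply: (subsetP (nbA x xA)); rewrite inE; apply: next_cycle.
have prevA x : x \in A -> prev c x \in B.
  move=> xA; apply: (subsetP (nbA x xA)); rewrite inE adj_sym.
  by rewrite -{2}(next_prev Uc x); apply: next_cycle.
have AB x : x \in A -> x \notin B by move=> xA; rewrite (disjointFr dAB).
pose D := [set x in B | next c x \in B].
have leF : #|F| <= #|D|.
  have sub : F \subset [set [set x; next c x] | x in D].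
    apply/subsetP => E EF; have := subsetP Fc _ EF.
    rewrite cycle_edgesE // => /imsetP[x xc EE]; apply/imsetP; exists x => //.
    by have := FB _ EF; rewrite EE subUset !sub1set inE.
  exact: leq_trans (subset_leq_card sub) (leq_imset_card _ _).
have sub : prev c @: A :|: D \subset B.
  apply/subsetP => x /setUP[/imsetP[a aA ->]|]; first exact: prevA.
  by rewrite inE => /andP[].
have dis : [disjoint prev c @: A & D].
  rewrite disjoint_subset; apply/subsetP => x /imsetP[a aA ->].
  by rewrite inE /= inE (next_prev Uc) (negPf (AB a aA)) andbF.
have EB : prev c @: A :|: D = B.
  apply/eqP; rewrite eqEcard sub /=; move: (leq_card_setU (prev c @: A) D).
  rewrite -(leq_card_setU _ _) in dis; rewrite (eqP dis).
  rewrite card_imset; last exact: can_inj (next_prev Uc).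
  lia.
have closed x : x \in A :|: B -> next c x \in A :|: B.
  case/setUP => [/nextA xB|xinB]; first by rewrite inE xB orbT.
  have : x \in prev c @: A :|: D by rewrite EB.
  case/setUP=> [/imsetP[a aA ->]|]; first by rewrite next_prev // inE aA.
  by rewrite inE => /andP[_ xB]; apply/setUP; right.
have : fconnect (next c) a0 w by rewrite (fconnect_cycle (cycle_next Uc)) ?allc.
move=> /iter_findex Ew; case/negP: wAB; rewrite -Ew.
by elim: (findex (next c) a0 w) => [|j IHj] /=;
  [rewrite inE a0A | apply: closed].
Qed.

(* With a = i, b = i + l and w = n - 2i - l this is G_n^l(i). *)
Definition split_graph (a b w : nat) : sgraph :=
  join (complete b) (disjoint_union (edgeless a) (complete w)).

Lemma card_split_graph a b w : #|split_graph a b w| = a + b + w.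
Proof. by rewrite !card_sum !card_ord; lia. Qed.

Lemma degree_complete m (x : complete m) : degree x = m.-1.
Proof.
rewrite /degree; have -> : nbrs x = ~: [set x] by apply/setP => y;
  rewrite !inE eq_sym.
by have := cardsC1 x; rewrite card_ord.
Qed.

Lemma degree_edgeless m (x : edgeless m) : degree x = 0.
Proof. by apply: eq_card0 => y; rewrite !inE. Qed.

Lemma sum_split_graph (f : nat -> nat) a b w :
  \sum_(v : split_graph a b w) f (degree v) =
  b * f (a + b + w).-1 + a * f b + w * f (b + w).-1.
Proof.
rewrite big_sumType /= big_sumType /= addnA; congr (_ + _ + _).
- rewrite (eq_bigr (fun=> f (a + b + w).-1)) ?sum_nat_const ?card_ord // => x _.
  congr f; rewrite degree_join_inl degree_complete card_sum !card_ord.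
  (* The existence of [x] makes [b] positive, so the predecessors are not truncated. *)
  by case: x => x /=; lia.
- rewrite (eq_bigr (fun=> f b)) ?sum_nat_const ?card_ord // => x _.
  by rewrite degree_join_inr degree_union_inl degree_edgeless card_ord addn0.
- rewrite (eq_bigr (fun=> f (b + w).-1)) ?sum_nat_const ?card_ord // => x _.
  congr f; rewrite degree_join_inr degree_union_inr degree_complete card_ord.
  by case: x => x /=; lia.
Qed.

Lemma min_degree_split_graph d a b w : d <= b -> 0 < w ->
  d <= min_degree (split_graph a b w).
Proof.
move=> db w0; rewrite leq_min_degree ?card_split_graph ?addn_gt0 ?w0 ?orbT //.
apply/forallP => -[x|[x|x]]; last first.
- by rewrite degree_join_inr degree_union_inr degree_complete card_ord; lia.
- by rewrite degree_join_inr degree_union_inl degree_edgeless card_ord addn0.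
rewrite degree_join_inl degree_complete card_sum !card_ord; case: x => x /=;
  lia.
Qed.

Section SplitGraph.
Variables a b w : nat.
Hypotheses (a0 : 0 < a) (w0 : 0 < w).
Let G := split_graph a b w.
Let K : {set G} := [set x | if x is inl _ then true else false].
Let I : {set G} := [set x | if x is inr (inl _) then true else false].
Let z : G := inr (inr (Ordinal w0)).

Lemma card_split_clique : #|K| = b.
Proof.
rewrite card_sum_set -[[set _ | true]]/setT -[[set _ | false]]/set0.
by rewrite cardsT card_ord cards0 addn0.
Qed.

Lemma card_split_indep : #|I| = a.
Proof.
rewrite card_sum_set -[[set _ | false]]/set0 cards0 add0n card_sum_set.
rewrite -[[set _ | true]]/setT -[[set _ | false]]/set0.
by rewrite cardsT card_ord cards0 addn0.
Qed.

Lemma split_disjoint : [disjoint I & K].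
Proof. by rewrite disjoint_subset; apply/subsetP => -[x|x]; rewrite !inE. Qed.

Lemma split_indep_nbrs (x : G) : x \in I -> nbrs x \subset K.
Proof.
by case: x => [x|[x|x]]; rewrite inE // => _; apply/subsetP => -[y|[y|y]];
  rewrite !inE.
Qed.

Lemma split_indep_neq0 : I != set0.
Proof. by rewrite -card_gt0 card_split_indep. Qed.

Lemma split_not_through (F : {set {set G}}) :
  (forall E, E \in F -> E \subset K) -> b <= a + #|F| -> ~ ham_through F.
Proof.
move=> FK leb; apply: (@no_hamilton_cycle G I K F z) => //.
- exact: split_indep_neq0.
- exact: split_disjoint.
- by rewrite !inE.
- exact: split_indep_nbrs.
- by rewrite card_split_clique card_split_indep.
Qed.

Lemma split_not_hamiltonian : b <= a -> ~ hamiltonian G.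
Proof.
move=> ba /hamiltonian_through0; apply: split_not_through => [E|];
  first by rewrite inE.
by rewrite cards0 addn0.
Qed.

(** In the cone the apex joins [K], giving a separating set of [b.+1 <= a] vertices. *)
Lemma split_not_traceable : b < a -> ~ traceable G.
Proof.
move=> ba /traceable_hamiltonian_cone h.
have /h/hamiltonian_through0 : 1 < #|G| by rewrite card_split_graph; lia.
pose B' : {set join (complete 1) G} :=
  [set x | if x is inr y then y \in K else true].
pose A' : {set join (complete 1) G} :=
  [set x | if x is inr y then y \in I else false].
have cA : #|A'| = a.
  by rewrite card_sum_set -[[set _ | false]]/set0 cards0 -card_split_indep;
    apply: eq_card => x; rewrite inE.
have cB : #|B'| = b.+1.
  rewrite card_sum_set -[[set _ | true]]/setT cardsT card_ord
    -card_split_clique; congr _.+1.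
  by apply: eq_card => x; rewrite inE.
apply: (@no_hamilton_cycle _ A' B' set0 (inr z)).
- by rewrite -card_gt0 cA.
- rewrite disjoint_subset; apply/subsetP => -[x|x]; rewrite inE // => xI.
  by rewrite inE /= inE (disjointFr split_disjoint xI).
- by rewrite !inE.
- move=> [x|x]; rewrite inE // => xI; apply/subsetP => -[y|y];
    rewrite !in_set // => xy.
  by have := subsetP (split_indep_nbrs xI) y; rewrite !in_set; apply.
- by move=> E; rewrite inE.
- by rewrite cards0 cA cB addn0.
Qed.

(** A Hamilton path between two vertices of [K] would close up along their edge to a cycle through
    it, but one edge inside [K] is too many when [b = a.+1]. *)
Lemma split_not_hamiltonian_connected : b = a.+1 -> ~ hamiltonian_connected G.
Proof.
move=> ba hc; have b0 : 0 < b by lia.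
have b1 : 1 < b by lia.
pose x : G := inl (Ordinal b0); pose y : G := inl (Ordinal b1).
have nxy : x != y by [].
have [p [hp lp]] := hc x y nxy.
have cG : 2 < #|G| by rewrite card_split_graph; lia.
have h := ham_connected_through cG nxy hp lp.
apply: (@split_not_through [set [set x; y]]).
- by move=> E /set1P ->; rewrite subUset !sub1set !inE.
- by rewrite cards1 ba addn1.
apply: ham_through_mono h => u v; case/orP=> // /andP[_ /eqP E].
by change (is_true (@adj G u v)); rewrite -mem_edges E mem_edges.
Qed.

(** The forest is a path with [k] edges inside [K]; it fits because [0 < a] gives [k < b]. *)
Lemma split_not_k_edge_hamiltonian k : b = a + k -> ~ k_edge_hamiltonian G k.
Proof.
move=> ba kG; pose q := take k.+1 (enum 'I_b); pose p : seq G := map inl q.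
have Uq : uniq q by rewrite take_uniq ?enum_uniq.
have Up : uniq p by rewrite map_inj_uniq // => x y [].
have szp : size p = k.+1 by rewrite size_map size_takel // size_enum_ord ba;
  lia.
have cF : #|path_edges p| = k by rewrite card_path_edges // szp.
have FK E : E \in path_edges p -> E \subset K.
  by move/path_edges_sub => sE; apply/subsetP => x /sE/mapP[y _ ->];
    rewrite inE.
apply: (split_not_through FK); first by rewrite cF ba.
apply: kG; last by rewrite cF.
exists [:: p]; rewrite big_seq1 /= cats0; split=> //; rewrite andbT sorted_map.
by have := @sorted_complete (complete b) _ q Uq; apply.
Qed.

Lemma card_preim_delete (H : sgraph) (S X : {set H}) :
  #|[set x : delete S | val x \in X]| = #|X :\: S|.
Proof.
rewrite -(card_imset _ val_inj); apply: eq_card => x; rewrite inE.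
apply/imsetP/andP => [[y + ->]|[xS xX]]; first by rewrite inE (valP y).
by exists (exist _ x xS); rewrite ?inE.
Qed.

(** Deleting [k] vertices of [K] leaves [a] of them, no more than there are independent vertices. *)
Lemma split_not_k_hamiltonian k : b = a + k -> ~ k_hamiltonian G k.
Proof.
move=> ba kG; pose S : {set G} := [set inl x | x in [set x : 'I_b | x < k]].
have inl_inj : injective (inl : complete b -> G) by move=> x y [].
have cS : #|S| = k.
  have kb : k <= b by lia.
  rewrite card_imset //; pose g := widen_ord kb.
  have -> : [set x : 'I_b | x < k] = g @: setT.
    apply/setP => x; rewrite inE; apply/idP/imsetP => [xk|[j _ ->]];
      last exact: (ltn_ord j).
    by exists (Ordinal xk) => //; apply: val_inj.
  by rewrite card_imset ?cardsT ?card_ord // => i j /(congr1 val)/= /val_inj.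
have := kG S; rewrite cS leqnn => /(_ isT)/hamiltonian_through0.
have SK : S \subset K by apply/subsetP => x /imsetP[y _ ->]; rewrite inE.
have SI : I :\: S = I.
  by apply/setDidPl; apply: disjointWr SK split_disjoint.
have zS : z \notin S by apply/imsetP => -[].
apply: (@no_hamilton_cycle _ [set x : delete S | val x \in I]
  [set x : delete S | val x \in K] set0 (exist _ z zS)).
- by rewrite -card_gt0 card_preim_delete SI card_split_indep.
- rewrite disjoint_subset; apply/subsetP => x; rewrite inE => xI.
  by rewrite inE /= inE (disjointFr split_disjoint xI).
- by rewrite !inE.
- move=> x; rewrite inE => xI; apply/subsetP => y; rewrite !inE => xy.
  by have := subsetP (split_indep_nbrs xI) (val y); rewrite !inE; apply.
- by move=> E; rewrite inE.
- rewrite cards0 addn0 !card_preim_delete SI card_split_indep cardsD (setIidPr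
    SK).
  by rewrite card_split_clique cS ba addnK.
Qed.

End SplitGraph.

(** * Counting stars *)

(** For [t = 1] each edge is counted from both ends. Keeping the factor explicit allows one
    treatment of all [t]. *)
Lemma num_stars_sum (G : sgraph) t : 0 < t ->
  \sum_(v : G) 'C(degree v, t) = (t == 1).+1 * num_stars t G.
Proof.
case: t => [|[|t]] // _; last by rewrite num_stars_ge2 // mul1n.
rewrite num_stars1 mul2n -handshake; apply: eq_bigr => v _; exact: bin1.
Qed.

(** The value [f (degree v)] stays at most [f n.-1] after adding [f q - f p] when [degree v <= p]
    and [f n.-1 - f q] when [degree v <= q]. Summing over [v] and inserting the two counts gives the
    bound. *)
Lemma leq_sum_degrees (G : sgraph) (f : nat ->
  nat) n p q r s : {homo f : x y / x <= y} ->
    #|G| = n -> p <= q <= n.-1 ->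
    r <= #|[set v : G | degree v <= p]| ->
      r + s <= #|[set v : G | degree v <= q]| ->
  \sum_(v : G) f (degree v) <= r * f p + s * f q + (n - (r + s)) * f n.-1.
Proof.
move=> fmono cG /andP[pq qn] lep leq.
have fpq := fmono _ _ pq; have fqn := fmono _ _ qn.
have : \sum_(v : G) f (degree v) + #|[set v : G | degree v <= p]| * (f q - f p)
     + #|[set v : G | degree v <= q]| * (f n.-1 - f q) <= n * f n.-1.
  rewrite -!sum_nat_const !(big_mkcond (fun v => v \in _)) /= -!big_split /=.
  rewrite -cG -sum_nat_const; apply: leq_sum => v _; rewrite !inE.
  have dn : degree v <= n.-1.
    rewrite -cG -(cardsC1 v); apply/subset_leq_card/subsetP => w.
    by rewrite !inE; apply: contraTneq => ->; rewrite adj_irrefl.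
  have := fmono _ _ dn; case: (leqP (degree v) p) => [dp|_].
    by have := fmono _ _ dp; rewrite (leq_trans dp pq) cG; lia.
  by case: (leqP (degree v) q) => [dq|_]; rewrite cG; [have := fmono _ _ dq|];
    lia.
have rsn : r + s <= n by apply: leq_trans leq _; rewrite -cG max_card.
have := leq_mul lep (leqnn (f q - f p));
  have := leq_mul leq (leqnn (f n.-1 - f q)).
nia.
Qed.

Lemma leq_bin2r a b t : a <= b -> 'C(a, t) <= 'C(b, t).
Proof.
move=> /subnK <-; elim: (b - a) => // k IHk; apply: leq_trans IHk _.
by case: t => [|t]; rewrite ?bin0 // addSn binS leq_addr.
Qed.

(** By Pascal's rule the increments of ['C(_, t.+1)] are values of ['C(_, t)], which is monotone. *)
Lemma bin_convex a t : 2 * 'C(a.+1, t) <= 'C(a, t) + 'C(a.+2, t).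
Proof.
case: t => [|t]; rewrite ?bin0 // [in X in _ <= _ + X]binS [in X in X <= _]binS.
have := @leq_bin2r a a.+1 t (leqnSn a); rewrite (binS a t); lia.
Qed.

Lemma convex_max (f : nat -> nat) a b :
    (forall i, a < i < b -> 2 * f i <= f i.-1 + f i.+1) ->
  forall i, a <= i <= b -> f i <= maxn (f a) (f b).
Proof.
elim: b => [|b IHb] conv i.
  by rewrite leqn0 andbC => /andP[/eqP->]; rewrite leqn0 => /eqP->;
    rewrite leq_max leqnn.
have IH j : a <= j <= b -> f j <= maxn (f a) (f b).
  by apply: IHb => k kab; apply: conv; lia.
case/andP=> ai; rewrite leq_eqVlt => /predU1P[->|ib];
  first by rewrite leq_max leqnn orbT.
have := IH i; rewrite ai -ltnS ib => /(_ isT).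
case: (leqP (f b) (f b.+1)) => [|lt]; first by lia.
have [->|ltab] := eqVneq a b; first by lia.
(* Now [f b.+1 < f b], so convexity gives [f b < f b.-1]; then [IH] bounds [f b.-1] by [f a], which
   is the maximum. *)
have := conv b; have := IH b.-1; lia.
Qed.

(* The number of t-stars of G_n^l(i) (twice that number if t = 1), for
   m = l + 1. *)
Definition star_sum (n m t i : nat) : nat :=
  i * 'C((i + m).-1, t) + (n.+1 - (2 * i + m)) * 'C(n.-1 - i, t) +
  (i + m).-1 * 'C(n.-1, t).

(** The last term is linear in [i]. In each other term a linear coefficient and a convex binomial
    are monotone in the same direction, so the second difference is the middle coefficient times
    that of the binomial, plus a nonnegative rest. *)
Lemma star_sum_convex n m t i : 1 < i -> 2 * i.+1 + m <= n ->
  2 * star_sum n m t i <= star_sum n m t i.-1 + star_sum n m t i.+1.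
Proof.
case: i => [|[|i]] // _ lei; rewrite /star_sum /=.
rewrite !addSn /=; set a := i + m.
have [D ED] : exists D, n.-1 - i.+3 = D by eexists.
have [w Ew] : exists w, n.+1 - (2 * i.+3 + m) = w by eexists.
have -> : n.-1 - i.+2 = D.+1 by lia.
have -> : n.-1 - i.+1 = D.+2 by lia.
have -> : n.+1 - (2 * i.+2 + m) = w + 2 by lia.
have -> : n.+1 - (2 * i.+1 + m) = w + 4 by lia.
rewrite ED Ew.
have c1 := bin_convex a t; have c2 := bin_convex D t.
have m1 := @leq_bin2r a a.+2 t (leq_trans (leqnSn _) (leqnSn _)).
have m2 := @leq_bin2r D D.+2 t (leq_trans (leqnSn _) (leqnSn _)).
move: ('C(a, t)) ('C(a.+1, t)) ('C(a.+2, t)) c1 m1 => x0 x1 x2 c1 m1.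
move: ('C(D, t)) ('C(D.+1, t)) ('C(D.+2, t)) c2 m2 => y0 y1 y2 c2 m2.
move: ('C(n.-1, t)) => z.
have h1 := leq_mul (leqnn i.+2) c1.
have h2 := leq_mul (leqnn (w + 2)) c2.
nia.
Qed.

Lemma star_sum_split n m t i : 0 < i -> 2 * i + m <= n ->
  \sum_(v : split_graph i (i + m).-1 (n.+1 - (2 * i + m))) 'C(degree v, t) =
    star_sum n m t i.
Proof.
move=> i0 im; rewrite (sum_split_graph (fun x => 'C(x, t))) /star_sum.
have -> : (i + (i + m).-1 + (n.+1 - (2 * i + m))).-1 = n.-1 by lia.
have -> : ((i + m).-1 + (n.+1 - (2 * i + m))).-1 = n.-1 - i by lia.
lia.
Qed.

(** The index given by [chvatal_degrees] lies between the two arguments of [star_sum] on the right,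
    and a convex function is largest at an end of the interval. *)
Lemma leq_star_sum (P : sgraph -> Prop) n m d t : m.+2 <= n ->
    (forall H : sgraph, #|H| = n -> (forall u v : H, u != v -> adj u v) ->
      P H) ->
    (forall (H : sgraph) (u v : H), #|H| = n -> u != v ->
       n + m <= (degree u + degree v).+1 -> P (add_edge u v) -> P H) ->
  forall G : sgraph, #|G| = n -> ~ P G -> d <= min_degree G ->
  \sum_(v : G) 'C(degree v, t) <=
    maxn (star_sum n m t (maxn 1 (d.+1 - m))) (star_sum n m t (n - m)./2).
Proof.
move=> mn Pc Ps G cG nP dG.
have [i [i0 im ci1 ci2]] := chvatal_degrees mn Pc Ps cG nP.
have di : d < i + m.
  (* Some vertex has degree below [i + m], and its degree is at least [d]. *)
  have : 0 < #|[set v : G | degree v < i + m]| by apply: leq_trans ci1.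
  case/card_gt0P => v; rewrite inE => dv; apply: (leq_ltn_trans _ dv).
  by move: dG; rewrite leq_min_degree; [move/forallP | rewrite cG; lia].
apply: (@leq_trans (star_sum n m t i)); last first.
  apply: (@convex_max (star_sum n m t)) => [j /andP[j1 j2]|]; last by lia.
  by apply: star_sum_convex; lia.
rewrite /star_sum.
(* The three blocks of vertices match the independent set, the outer clique and the joined clique of
   the extremal graph. *)
have := @leq_sum_degrees G (fun x => 'C(x, t)) n (i + m).-1 (n.-1 - i) i (n.+1
  - (2 * i + m)).
have -> : n - (i + (n.+1 - (2 * i + m))) = (i + m).-1 by lia.
apply=> //; first by move=> x y; apply: leq_bin2r.
- lia.
- by apply: leq_trans ci1 _; apply/subset_leq_card/subsetP => v; rewrite !inE;
    lia.
- have E : [set v : G | degree v < n - i] = [set v : G | degree v <= n.-1 - i].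
    by apply/setP => v; rewrite !inE; lia.
  rewrite -E; lia.
Qed.

(** * The bound and its attainment *)

Lemma extremal_graphE (n m i : nat) (l : int) : l = (m%:Z - 1)%R -> 0 < i ->
  2 * i + m <= n ->
  extremal_graph n l i%:Z = split_graph i (i + m).-1 (n.+1 - (2 * i + m)).
Proof.
move=> -> i0 im; rewrite /extremal_graph /split_graph.
by congr (join (complete _) (disjoint_union (edgeless _) (complete _))); lia.
Qed.

Theorem theorem5 (n : nat) (l : int) (t d : nat)
    (hl : (-1 <= l <= n%:Z - 3)%R)
    (ht : 1 <= t <= n - 1)
    (hd : (d%:Z <= ((n%:Z + l - 1)%R %/ 2)%Z)%R) :
  let i_d : int := Num.max 1%R (d%:Z - l)%R in
  let i_0 : int := ((n%:Z - 1 - l)%R %/ 2)%Z in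
  let bound := maxn (num_stars t (extremal_graph n l i_d))
                    (num_stars t (extremal_graph n l i_0)) in
  (forall G : sgraph, #|G| = n -> d <= min_degree G ->
     [\/ ~ hamiltonian G /\ l = 0%R,
         ~ traceable G /\ l = (-1)%R,
         ~ hamiltonian_connected G /\ l = 1%R |
         (exists k : nat,
            [/\ 1 <= k <= n - 3, ~ k_edge_hamiltonian G k & l = k%:Z%R]) \/
         (exists k : nat,
            [/\ 1 <= k <= n - 3, ~ k_hamiltonian G k & l = k%:Z%R])] ->
     num_stars t G <= bound) /\
  (let attained (P : sgraph -> Prop) :=
     exists G : sgraph,
       [/\ #|G| = n, d <= min_degree G, ~ P G & num_stars t G = bound] in
   [/\ l = 0%R -> attained hamiltonian,
       l = (-1)%R -> attained traceable,
       l = 1%R -> attained hamiltonian_connected,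
       (forall k : nat, 1 <= k <= n - 3 -> l = k%:Z%R ->
          attained (fun G => k_edge_hamiltonian G k))
     & (forall k : nat, 1 <= k <= n - 3 -> l = k%:Z%R ->
          attained (fun G => k_hamiltonian G k))]).
Proof.
have [m lE] : exists m : nat, l = (m%:Z - 1)%R by exists (absz (l + 1)%R); lia.
have mn : m.+2 <= n by lia.
(* With [m = l + 1] these are [i_d] and [i_0]; where [d.+1 - m] is truncated, the maximum with 1
   absorbs it. *)
pose a := maxn 1 (d.+1 - m); pose b := (n - m)./2.
have dm : (2 * d).+2 <= n + m by lia.
have a0 : 0 < a by lia.
have b0 : 0 < b by rewrite /b; lia.
have am : 2 * a + m <= n by rewrite /a; lia.
have bm : 2 * b + m <= n by rewrite /b; lia.
move=> i_d i_0.
have -> : i_d = Posz a by rewrite /i_d /a; lia.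
have -> : i_0 = Posz b by rewrite /i_0 /b; lia.
rewrite !(extremal_graphE lE) // => bound.
have t0 : 0 < t by case/andP: ht.
split=> [G cG dG H|attained].
  suff [P [nP Pc Ps]] : exists P : sgraph -> Prop,
    [/\ ~ P G,
        forall H : sgraph, #|H| = n -> (forall u v : H, u != v -> adj u v) ->
          P H
      & forall (H : sgraph) (u v : H), #|H| = n -> u != v ->
          n + m <= (degree u + degree v).+1 -> P (add_edge u v) -> P H].
    have := leq_star_sum t mn Pc Ps cG nP dG.
    (* Both sides carry the same positive factor from [num_stars_sum], which cancels. *)
    rewrite -/a -/b -!star_sum_split // !num_stars_sum // -maxnMr.
    by rewrite leq_pmul2l.
  case: H => [[nP lH]|[nP lH]|[nP lH]|[[k [k1 nP lH]]|[k [k1 nP lH]]]].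
  - exists hamiltonian; split=> // [H cH adjH|H u v cH nuv le_s].
      by apply: hamiltonian_complete => //; lia.
    by apply: hamiltonian_stable => //; lia.
  - exists traceable; split=> // [H cH adjH|H u v cH nuv le_s].
      exact: traceable_complete.
    by apply: traceable_stable => //; lia.
  - exists hamiltonian_connected; split=> // [H cH adjH|H u v cH nuv le_s].
      exact: hamiltonian_connected_complete.
    by apply: hamiltonian_connected_stable => //; lia.
  - exists (fun H => k_edge_hamiltonian H k);
      split=> // [H cH adjH|H u v cH nuv le_s].
      by apply: k_edge_hamiltonian_complete => //; lia.
    by apply: k_edge_hamiltonian_stable => //; lia.
  - exists (fun H => k_hamiltonian H k);
      split=> // [H cH adjH|H u v cH nuv le_s].
      by apply: k_hamiltonian_complete => //; lia.
    by apply: k_hamiltonian_stable => //; lia.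
(* Both candidates are split graphs with admissible parameters, so whichever has more stars can
   serve as the witness. *)
have att (P : sgraph -> Prop) : (forall i w, 0 < i -> 0 < w ->
  ~ P (split_graph i (i + m).-1 w)) ->
    attained P.
  move=> nP; rewrite /attained /bound.
  have props i : 0 < i -> 2 * i + m <= n -> d < i + m ->
      [/\ #|split_graph i (i + m).-1 (n.+1 - (2 * i + m))| = n,
          d <= min_degree (split_graph i (i + m).-1 (n.+1 - (2 * i + m)))
        & ~ P (split_graph i (i + m).-1 (n.+1 - (2 * i + m)))].
    move=> i0 im di; split; first by rewrite card_split_graph; lia.
      by apply: min_degree_split_graph; lia.
    by apply: nP; lia.
  case: leqP => _.
    by have [] := props b b0 bm; [rewrite /b; lia | eexists; split; eauto].
  by have [] := props a a0 am; [rewrite /a; lia | eexists; split; eauto].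
split=> [lH|lH|lH|k k1 lH|k k1 lH]; apply: att => i w i0 w0.
- by apply: split_not_hamiltonian => //; lia.
- by apply: split_not_traceable => //; lia.
- by apply: split_not_hamiltonian_connected => //; lia.
- by apply: split_not_k_edge_hamiltonian => //; lia.
- by apply: split_not_k_hamiltonian => //; lia.
Qed.
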